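(* Let $(X,d,\mu)$ be a metric measure space, fix $1<p<\infty$, and set $q=p/(p-1)$. Let $I$ be a finite or countably infinite index set, let $\{w_n\}_{n\in I}$ be weights with $w_n>0$, let $\{t_n\}_{n\in I}$ be dilations with $t_n\ge 1$, and let $\{U(x_n,r_n)\}_{n\in I}$ be balls in $X$ with $\mu U(x_n,r_n)>0$ for every $n\in I$. Then $$ \left\| \sum_{n \in I}\frac{w_n \mathbf{1}_{U(x_{n}, t_n r_{n})} }{\mu U(x_{n}, t_n r_{n})} \right\|_{L^p (\mu)} \le \left\|M^u_{\mu} \right\|_{L^q (\mu) \to L^q (\mu)} \left\| \sum_{n \in I}\frac{w_n \mathbf{1}_{U(x_{n}, r_{n})} }{\mu U(x_{n}, r_{n})} \right\|_{L^p (\mu)}. $$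
   Context: A Borel measure $\mu$ on a metric space $(X,d)$ is $\tau$-additive if for every collection $\{U_\alpha\}_{\alpha\in\Lambda}$ of open sets, $\mu(\cup_\alpha U_\alpha)=\sup \mu(\cup_{i=1}^n U_{\alpha_i})$, the supremum being over all finite subcollections. A metric measure space $(X,d,\mu)$ is a metric space with a $\tau$-additive Borel measure $\mu$, not identically zero, that is finite on bounded Borel sets. Balls: $B(x,r)=\{y: d(x,y)<r\}$ and $B^{cl}(x,r)=\{y: d(x,y)\le r\}$; radii are always $>0$. $U(x,r)$ denotes a ball that may be either $B(x,r)$ or $B^{cl}(x,r)$ (collections may be mixed), but $U(x_n,r_n)$ and its dilation $U(x_n,t_nr_n)$ are both open or both closed. The uncentered Hardy-Littlewood maximal operator is, for $g$ locally integrable, $$M^u_{\mu} g(x) := \sup _{\{r > 0,\ y\in X :\ d(x,y) < r,\ \mu B^{cl}(y, r) > 0\}} \frac{1}{\mu (B^{cl}(y, r))} \int _{B^{cl}(y, r)} |g| \, d\mu .$$ $\|M^u_\mu\|_{L^q(\mu)\to L^q(\mu)}$ is the smallest $c\in[0,\infty]$ with $\|M^u_\mu g\|_{L^q(\mu)}\le c\|g\|_{L^q(\mu)}$ for all $g\in L^q(\mu)$; if it is $\infty$ the inequality is understood as trivially true. *)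

(* Defs.v *)
From HB Require Import structures.
From mathcomp Require Import all_boot all_order all_algebra.
From mathcomp Require Import all_classical all_reals all_analysis.

Set Implicit Arguments.
Unset Strict Implicit.
Unset Printing Implicit Defensive.
Import Order.TTheory GRing.Theory Num.Theory.

Local Open Scope classical_set_scope.
Local Open Scope ring_scope.

(* The measurable types of the library are pointed; nothing is lost for spaces
   carrying a nonzero measure, which are nonempty. *)
HB.mixin Record hasBorelMeasurable (d : measure_display) (R : realType) X
    & Measurable d X & Metric R X := {
  measurable_borelE : @measurable d X = <<s @open X >> }.

#[short(type="borelMetricType")]
HB.structure Definition BorelMetric (d : measure_display) (R : realType) :=
  { X of Measurable d X & Metric R X & hasBorelMeasurable d R X }.

Section metric_measure_space.
Context {d : measure_display} {R : realType} {X : borelMetricType d R}.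
Implicit Types (x y : X) (r : R).

Definition metric_bounded (A : set X) : Prop :=
  exists M : R, forall x y, A x -> A y -> mdist x y <= M.

Local Open Scope ereal_scope.

Definition tau_additive (mu : {measure set X -> \bar R}) : Prop :=
  forall (L : Type) (Lam : set L) (U : L -> set X),
    (forall a, Lam a -> open (U a)) ->
    mu (\bigcup_(a in Lam) U a) =
    ereal_sup [set mu (\bigcup_(a in F) U a) |
               F in [set F : set L | finite_set F /\ F `<=` Lam]].

Definition metric_measure (mu : {measure set X -> \bar R}) : Prop :=
  [/\ tau_additive mu,
      exists2 A : set X, measurable A & mu A != 0 &
      forall A : set X, measurable A -> metric_bounded A -> mu A < +oo].

(* The closed ball {y : d(x,y) <= r}; the library's [closed_ball x r] is the
   closure of the open ball, which can be strictly smaller. *)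
Definition cball x r : set X := [set y | (mdist x y <= r)%R].

(* [c] selects the closed ball; [ball x r] is {y : d(x,y) < r} by
   [ballEmdist]. *)
Definition Uball (c : bool) x r : set X := if c then cball x r else ball x r.

(* For a [metric_measure], the supremum ranges over a nonempty set, and the
   averages are over sets of positive finite measure. *)
Definition uncentered_maximal (mu : {measure set X -> \bar R})
    (g : X -> R) (x : X) : \bar R :=
  ereal_sup [set (mu (cball yr.1 yr.2))^-1 *
                 \int[mu]_(z in cball yr.1 yr.2) `|(g z)%:E| |
             yr in [set yr : X * R | [/\ (0 < yr.2)%R,
                                         (mdist x yr.1 < yr.2)%R &
                                         0 < mu (cball yr.1 yr.2)]]].

Definition uncentered_maximal_norm (mu : {measure set X -> \bar R})
    (q : R) : \bar R :=
  ereal_inf [set c : \bar R | 0 <= c /\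
    forall g : X -> R, g \in Lfun mu q%:E ->
      'N[mu]_(q%:E)[uncentered_maximal mu g]
        <= c * 'N[mu]_(q%:E)[EFin \o g]].

End metric_measure_space.

(* Main.v *)
Require Import Defs.
From mathcomp Require Import all_boot all_order all_algebra.
From mathcomp Require Import all_classical all_reals all_analysis.
From mathcomp Require Import measurable_realfun ring lra.

(** Write F for the weighted sum over the balls B_n = U(x_n, r_n) and F_t for
the sum over the dilated balls t_n B_n. By duality the L^p norm of F_t is
controlled by its pairings with nonnegative g in L^q, and each pairing is a
weighted sum of averages of g over the t_n B_n. Every point z of B_n is also a
point of t_n B_n, so such an average is at most M g(z)
([integral_Uball_le_maximal]); averaging this bound over z in B_n replaces the
average of g over t_n B_n by the average of M g over B_n
([average_dilation_le]). Summing over n gives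

   int F_t g  <=  int F (M g)  <=  |F|_p |M g|_q  <=  |M| |F|_p |g|_q,

where the second step is the Hoelder inequality and |M| is the operator norm.

The averages defining M are over closed balls of radius strictly larger than
the distance from the centre to z. An open ball containing z is the increasing
union of such closed balls, and a closed ball containing z is their decreasing
intersection, so continuity of measures covers both kinds of balls.

F, F_t and M g may take the value +oo, hence Hoelder's inequality and duality
are needed for extended-real functions ([hoelder_ereal], [Lnorm_le_dual]).
With the convention 0 * +oo = 0 the chain above also holds when |F|_p or |M| is
0 or +oo; only test functions of norm 0 are handled apart, because for them the
last step does not follow from the definition of |M| as an infimum. *)

Set Implicit Arguments.
Unset Strict Implicit.
Unset Printing Implicit Defensive.
Import Order.TTheory GRing.Theory Num.Theory.

Local Open Scope classical_set_scope.
Local Open Scope ring_scope.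
Local Open Scope ereal_scope.

(** * Balls in a metric space with its Borel sets *)

Section metric_balls.
Context (d : measure_display) (R : realType) (X : borelMetricType d R).
Implicit Types (x y z : X) (r s : R).

Lemma open_borel_measurable (A : set X) : open A -> measurable A.
Proof. by move=> oA; rewrite measurable_borelE; exact: sub_sigma_algebra. Qed.

Lemma ball_is_open x r : open (ball x r).
Proof.
rewrite openE => y; rewrite ballEmdist /= => xy.
rewrite /interior; apply/nbhs_ballP; exists (r - mdist x y)%R => /=.
  by rewrite subr_gt0.
move=> z; rewrite !ballEmdist /= ltrBrDl; apply: le_lt_trans.
exact: metric_triangle.
Qed.

Lemma measurable_mball x r : measurable (ball x r).
Proof. exact/open_borel_measurable/ball_is_open. Qed.

Lemma measurable_cball x r : measurable (cball x r).
Proof.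
rewrite -(setCK (cball x r)); apply/measurableC/open_borel_measurable.
rewrite openE => y /= /negP; rewrite -ltNge => xy.
rewrite /interior; apply/nbhs_ballP; exists (mdist x y - r)%R => /=.
  by rewrite subr_gt0.
move=> z; rewrite ballEmdist /= ltrBrDl => yz; apply/negP; rewrite -ltNge.
rewrite -(ltrD2r (mdist y z)); apply: (lt_le_trans yz).
by rewrite (metric_sym y z); exact: metric_triangle.
Qed.

Lemma measurable_Uball b x r : measurable (Uball b x r).
Proof. by case: b; [exact: measurable_cball|exact: measurable_mball]. Qed.

Lemma Uball_sub_cball b x r : Uball b x r `<=` cball x r.
Proof. by case: b => //= y; rewrite ballEmdist /cball /= => /ltW. Qed.

Lemma cball_bounded x r : metric_bounded (cball x r).
Proof.
exists (r + r)%R => y z xy xz; apply: (le_trans (metric_triangle y x z)).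
by rewrite lerD // metric_sym.
Qed.

Lemma le_Uball b x r s : (r <= s)%R -> Uball b x r `<=` Uball b x s.
Proof.
move=> rs; case: b => y /=; rewrite /cball ?ballEmdist /= => xy.
  exact: le_trans rs.
exact: lt_le_trans rs.
Qed.

(** The first radius of the increasing sequence is [s]: all the closed balls
contain every point at distance less than [s] from the centre. *)
Lemma ball_bigcup_cball x r s : (s < r)%R ->
  ball x r = \bigcup_n cball x (r - (r - s) / n.+1%:R).
Proof.
move=> sr; have rs0 : (0 < r - s)%R by rewrite subr_gt0.
apply/seteqP; split=> y; rewrite ballEmdist /=.
  move=> xy; have : (0 < (r - mdist x y) / (r - s))%R.
    by rewrite divr_gt0 // subr_gt0.
  move=> /ltr_add_invr[n]; rewrite add0r ltr_pdivlMr // => nxy.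
  by exists n => //; rewrite /cball /= lerBrDl -lerBrDr mulrC ltW.
case=> n _; rewrite /cball /= => /le_lt_trans; apply.
by rewrite gtrBl divr_gt0.
Qed.

Lemma cball_bigcap_cball x r : cball x r = \bigcap_n cball x (r + n.+1%:R^-1).
Proof.
apply/seteqP; split=> y.
  by move=> xy n _; rewrite /cball/=; apply: (le_trans xy); rewrite lerDl.
move=> h; rewrite /cball /= leNgt; apply/negP => /ltr_add_invr[n].
by rewrite ltNge => /negP; apply; exact: (h n).
Qed.

End metric_balls.

(** * Averages over balls and the uncentered maximal function *)

Section uncentered_averages.
Context (d : measure_display) (R : realType) (X : borelMetricType d R).
Variable mu : {measure set X -> \bar R}.
Implicit Types (g : X -> R) (x y z : X) (r s : R).

(** The maximal function is lower semicontinuous: a ball that contains x in its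
open interior and has a large average serves every point near x. *)
Lemma measurable_uncentered_maximal g :
  measurable_fun [set: X] (uncentered_maximal mu g).
Proof.
apply: (measurability _ (ErealGenOInfty.measurableE R)) => // _ [_ [a ->] <-].
rewrite setTI; apply: open_borel_measurable.
rewrite openE => x /=; rewrite in_itv /= andbT.
move=> /ereal_sup_gt[_ [[y r]] /= [r0 xy mur] <-] ha.
rewrite /interior; apply/nbhs_ballP; exists (r - mdist x y)%R => /=.
  by rewrite subr_gt0.
move=> z; rewrite ballEmdist /= ltrBrDl => xz.
rewrite in_itv /= andbT; apply: (lt_le_trans ha).
apply: ereal_sup_ubound; exists (y, r) => //=; split => //.
apply: le_lt_trans xz.
by rewrite addrC (metric_sym x z); exact: metric_triangle.
Qed.

Hypothesis mu_fin : forall x r, mu (cball x r) < +oo.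

(** Multiplying the average out makes the bound meaningful, and true, for balls
of measure zero. The absolute value removes the value -oo that the supremum
takes at a point without balls of positive measure. *)
Lemma integral_cball_le_maximal g y r z : measurable_fun setT g ->
  (mdist y z < r)%R ->
  \int[mu]_(u in cball y r) `|(g u)%:E| <=
    `|uncentered_maximal mu g z| * mu (cball y r).
Proof.
move=> mg yz.
have mc := measurable_cball y r.
have [mu0|mu0] := eqVneq (mu (cball y r)) 0.
  rewrite mu0 mule0 null_set_integral //.
  apply: (measurable_funS measurableT) => //.
  apply: measurableT_comp => //; exact/measurable_EFinP.
have mup : 0 < mu (cball y r) by rewrite lt0e mu0 measure_ge0.
have muf : mu (cball y r) \is a fin_num by rewrite ge0_fin_numE.
rewrite -[leLHS]mul1e -(mulVe mu0 muf) muleAC lee_pmul2r //.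
apply: le_trans (lee_abs _); apply: ereal_sup_ubound; exists (y, r) => //=.
split => //; last by rewrite metric_sym.
by apply: le_lt_trans yz; exact: mdist_ge0.
Qed.

(** The bound passes from closed balls containing [z] strictly inside to all
balls containing [z]: closed balls are approximated from outside, where the
measures on the right converge, and open balls from inside, where the integrals
on the left converge. *)
Lemma integral_Uball_le_maximal g b y r z : measurable_fun setT g ->
  0 < mu (Uball b y r) -> Uball b y r z ->
  \int[mu]_(u in Uball b y r) `|(g u)%:E| <=
    `|uncentered_maximal mu g z| * mu (Uball b y r).
Proof.
move=> mg mup Uz.
have mU := measurable_Uball b y r.
have muf : mu (Uball b y r) < +oo.
  apply: le_lt_trans (mu_fin y r); apply: le_measure; rewrite ?inE //.
    exact: measurable_cball.
  exact: Uball_sub_cball.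
have mag D : measurable_fun D (fun u => `|(g u)%:E|).
  apply: (measurable_funS measurableT) => //.
  apply: measurableT_comp => //; exact/measurable_EFinP.
have [->|Mfin] := eqVneq `|uncentered_maximal mu g z| +oo.
  by rewrite gt0_mulye // leey.
set m := `|_| in Mfin *.
have mfin : m \is a fin_num by rewrite ge0_fin_numE ?abse_ge0 // ltey.
case: b mU Uz mup muf => /= mU Uz mup muf.
- rewrite [in leRHS]cball_bigcap_cball.
  have mc n : measurable (cball y (r + n.+1%:R^-1)) by exact: measurable_cball.
  have cv := @nonincreasing_cvg_mu _ _ _ mu
    (fun n => cball y (r + n.+1%:R^-1)) (mu_fin _ _) mc
    (bigcap_measurable _ (fun k _ => mc k)).
  have {}cv := cvgeZl mfin (cv _ _).
  apply: cvge_to_ge (cv _ _) _.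
  - by exists 0%N.
  - move=> i j ij; apply/subsetPset; apply: (@le_Uball _ _ _ true).
    by rewrite lerD2l lef_pV2 ?posrE // ler_nat ltnS.
  apply: nearW => n /=; apply: le_trans (integral_cball_le_maximal _ _) => //.
    apply: ge0_subset_integral => //.
    by apply: (@le_Uball _ _ _ true); rewrite lerDl.
  by apply: (le_lt_trans Uz); rewrite ltrDl.
- have [s zs sr] : exists2 s, (mdist y z < s)%R & (s < r)%R.
    move: Uz; rewrite ballEmdist /= => yz.
    by exists ((mdist y z + r) / 2)%R; lra.
  rewrite [in leLHS](ball_bigcup_cball _ sr).
  set F := fun n => cball _ _.
  have Fr n : F n `<=` ball y r.
    by rewrite (ball_bigcup_cball _ sr) => u Fu; exists n.
  have cv := @ge0_nondecreasing_set_cvg_integral _ _ _ F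
    (fun u => `|(g u)%:E|) mu.
  apply: cvge_to_le (cv _ _ _ _) _ => //.
    - move=> i j ij; apply/subsetPset; apply: (@le_Uball _ _ _ true).
      rewrite lerD2l lerN2 ler_pM2l ?subr_gt0 //.
      by rewrite lef_pV2 ?posrE // ler_nat ltnS.
    - by move=> n; exact: measurable_cball.
  apply: nearW => n /=.
  apply: (le_trans (integral_cball_le_maximal mg _)).
    apply: (lt_le_trans zs); rewrite lerBrDl -lerBrDr.
    by rewrite ler_pdivrMr // ler_peMr // ?subr_ge0 ?(ltW sr) // ler1n.
  apply: lee_wpmul2l => //; apply: le_measure; rewrite ?inE //.
    exact: measurable_cball.
  exact: Fr.
Qed.

End uncentered_averages.

(** * Sums over a countable type under the integral *)

Section integral_esum.
Context (d : measure_display) (T : measurableType d) (R : realType).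
Variable mu : {measure set T -> \bar R}.
Context (I : countType).
Implicit Types (a : I -> \bar R) (f : I -> T -> \bar R).

(** Enumerating the index type turns the sum into a series, to which the
interchange of series and integrals applies. *)
Lemma esum_pickleE a : (forall i, 0 <= a i) ->
  \esum_(i in [set: I]) a i = \sum_(k <oo) oapp a 0 (@pickle_inv I k).
Proof.
move=> a0.
have oa0 k : 0 <= oapp a 0 (@pickle_inv I k) by case: pickle_inv.
rewrite nneseries_esumT // [RHS](esumID [set pickle i | i in [set: I]]) //.
rewrite [X in _ + X]esum1 => [|k [_ /= hk]]; last first.
  case e : (pickle_inv k) => [i|//]; exfalso; apply: hk; exists i => //.
  by have := @pickle_invK I k; rewrite /ocancel e.
rewrite adde0 setTI esum_image; last first.
  by move=> i j _ _; exact: (pcan_inj pickleK_inv).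
by apply: eq_esum => i _; rewrite pickleK_inv.
Qed.

Lemma measurable_fun_esum f : (forall i x, 0 <= f i x) ->
  (forall i, measurable_fun setT (f i)) ->
  measurable_fun setT (fun x => \esum_(i in [set: I]) f i x).
Proof.
move=> f0 mf; rewrite (_ : (fun _ => _) = fun x =>
    \sum_(k <oo | k \in predT) oapp (f^~ x) 0 (@pickle_inv I k)).
  apply: (ge0_emeasurable_sum
    (h := fun k x => oapp (f^~ x) 0 (@pickle_inv I k))) => k.
    by move=> x _ _; case: pickle_inv => /=.
  by move=> _; case: pickle_inv.
by apply/funext => x; rewrite esum_pickleE.
Qed.

Lemma integral_esum f : (forall i x, 0 <= f i x) ->
  (forall i, measurable_fun setT (f i)) ->
  \int[mu]_x (\esum_(i in [set: I]) f i x) =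
  \esum_(i in [set: I]) \int[mu]_x f i x.
Proof.
move=> f0 mf; rewrite esum_pickleE; last by move=> i; apply: integral_ge0.
under eq_integral do rewrite esum_pickleE //.
rewrite integral_nneseries => [|//| |]; first 1 last.
- by move=> k; case: pickle_inv.
- by move=> k x _; case: pickle_inv => /=.
by apply: eq_eseriesr => k _; case: pickle_inv => //=; rewrite integral0.
Qed.

Lemma esum_mulr (r : R) a : (0 <= r)%R -> (forall i, 0 <= a i) ->
  (\esum_(i in [set: I]) a i) * r%:E = \esum_(i in [set: I]) (a i * r%:E).
Proof.
move=> r0 a0; rewrite !esum_pickleE //; last by move=> i; rewrite mule_ge0.
rewrite muleC -nneseriesZl //; last by move=> k _; case: pickle_inv.
apply: eq_eseriesr => k _.
by case: pickle_inv => [i|] /=; rewrite ?mule0 // muleC.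
Qed.

(** The factor may be +oo here, which is why finite subsums are compared. *)
Lemma esum_mulr_le (c : \bar R) a : 0 <= c -> (forall i, 0 <= a i) ->
  \esum_(i in [set: I]) (a i * c) <= (\esum_(i in [set: I]) a i) * c.
Proof.
move=> c0 a0; apply: ge_ereal_sup => _ [A [finA _] <-].
rewrite -ge0_mule_fsuml //; apply: lee_wpmul2r => //.
by apply: ereal_sup_ubound; exists A.
Qed.

End integral_esum.

(** * Hoelder inequality and duality for extended-real functions *)

Section lnorm.
Import HBNNSimple.
Context (d : measure_display) (T : measurableType d) (R : realType).
Variable mu : {measure set T -> \bar R}.
Implicit Types (F G : T -> \bar R) (p q : R).

Lemma ge0_le_poweR (a b : \bar R) p : (0 <= p)%R -> 0 <= a -> a <= b ->
  a `^ p <= b `^ p.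
Proof.
by move=> p0 a0 ab; apply: gt0_ler_poweR => //;
  rewrite in_itv /= leey andbT // (le_trans a0).
Qed.

Lemma measurable_abse_poweR F p : measurable_fun setT F ->
  measurable_fun setT (fun x => `|F x| `^ p).
Proof.
move=> mF; apply: (measurableT_comp (measurable_poweR p)).
exact: measurableT_comp.
Qed.

Lemma Lnorm_fin_ae F p : (0 < p)%R -> measurable_fun setT F ->
  'N[mu]_p%:E[F] < +oo -> {ae mu, forall x, F x \is a fin_num}.
Proof.
move=> p0 mF NF.
have iF : mu.-integrable setT (fun x => `|F x| `^ p).
  apply/integrableP; split; first exact: measurable_abse_poweR.
  under eq_integral do rewrite gee0_abs ?poweR_ge0 //.
  rewrite -poweR_Lnorm ?gt_eqF //; exact: poweR_lty.
have := integrable_ae measurableT iF.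
apply: filterS => x /(_ Logic.I).
rewrite ge0_fin_numE ?poweR_ge0 // => /lty_poweRy.
rewrite gt_eqF // => /(_ isT).
by rewrite -ge0_fin_numE // fin_num_abs abse_id -fin_num_abs.
Qed.

Lemma Lnorm_ae_eq F G p : measurable_fun setT F -> measurable_fun setT G ->
  ae_eq mu setT F G -> 'N[mu]_p%:E[F] = 'N[mu]_p%:E[G].
Proof.
move=> mF mG FG; rewrite unlock; congr (_ `^ _).
apply: ge0_ae_eq_integral => //.
- exact: measurable_abse_poweR.
- exact: measurable_abse_poweR.
- by move=> x _; exact: poweR_ge0.
- by move=> x _; exact: poweR_ge0.
by apply: filterS FG => x /[apply] ->.
Qed.

(** If both norms are finite, [F] and [G] are almost everywhere finite and the
real-valued inequality applies to their finite parts; if one norm is 0 the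
product vanishes almost everywhere, and otherwise the bound is +oo. *)
Lemma hoelder_ereal F G p q :
  measurable_fun setT F -> measurable_fun setT G ->
  (0 < p)%R -> (0 < q)%R -> (p^-1 + q^-1 = 1)%R ->
  \int[mu]_x `|F x * G x| <= 'N[mu]_p%:E[F] * 'N[mu]_q%:E[G].
Proof.
move=> mF mG p0 q0 pq.
have mFG : measurable_fun setT (fun x => F x * G x) by exact: emeasurable_funM.
have [NF0|NF0] := eqVneq 'N[mu]_p%:E[F] 0.
  rewrite NF0 mul0e le_eqVlt; apply/orP; left; apply/eqP.
  apply/(ae_eq_integral_abs mu measurableT mFG).
  apply: filterS (Lnorm_eq0_eq0 mF _ NF0); last by rewrite lte_fin.
  by move=> x /[apply] ->; rewrite mul0e.
have [NG0|NG0] := eqVneq 'N[mu]_q%:E[G] 0.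
  rewrite NG0 mule0 le_eqVlt; apply/orP; left; apply/eqP.
  apply/(ae_eq_integral_abs mu measurableT mFG).
  apply: filterS (Lnorm_eq0_eq0 mG _ NG0); last by rewrite lte_fin.
  by move=> x /[apply] ->; rewrite mule0.
have NFp : 0 < 'N[mu]_p%:E[F] by rewrite lt0e NF0 Lnorm_ge0.
have NGp : 0 < 'N[mu]_q%:E[G] by rewrite lt0e NG0 Lnorm_ge0.
have [NFy|NFy] := eqVneq 'N[mu]_p%:E[F] +oo.
  by rewrite NFy gt0_mulye // leey.
have [NGy|NGy] := eqVneq 'N[mu]_q%:E[G] +oo.
  by rewrite NGy gt0_muley // leey.
pose f := fine \o F; pose g := fine \o G.
have mf : measurable_fun setT f by exact: measurableT_comp.
have mg : measurable_fun setT g by exact: measurableT_comp.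
have Ff : ae_eq mu setT F (EFin \o f).
  apply: filterS (Lnorm_fin_ae p0 mF _); last by rewrite ltey.
  by move=> x Fx _; rewrite /= fineK.
have Gg : ae_eq mu setT G (EFin \o g).
  apply: filterS (Lnorm_fin_ae q0 mG _); last by rewrite ltey.
  by move=> x Gx _; rewrite /= fineK.
rewrite (Lnorm_ae_eq p mF _ Ff); last exact/measurable_EFinP.
rewrite (Lnorm_ae_eq q mG _ Gg); last exact/measurable_EFinP.
apply: le_trans (hoelder mu mf mg p0 q0 pq); rewrite Lnorm1.
rewrite le_eqVlt; apply/orP; left; apply/eqP.
apply: ge0_ae_eq_integral => //.
- exact: measurableT_comp.
- apply: measurableT_comp => //; apply/measurable_EFinP; exact: measurable_funM.
- apply: filterS2 Ff Gg => x /= /(_ Logic.I) -> /(_ Logic.I) -> _.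
  by rewrite -EFinM.
Qed.

(** The natural test function F^(p-1) need not lie in L^q, so F^p is
approximated from below by bounded functions [e n] supported on sets of finite
measure. The test function (e n)^(1/q) satisfies e n <= F * (e n)^(1/q), whence
int e n <= K (int e n)^(1/q); as int e n is finite it can be divided out, and
int e n <= K^p passes to the limit. *)
Lemma Lnorm_le_dual F p q K : sigma_finite setT mu ->
  (1 < p)%R -> (p^-1 + q^-1 = 1)%R -> measurable_fun setT F ->
  (forall x, 0 <= F x) -> 0 <= K ->
  (forall g : T -> R, g \in Lfun mu q%:E -> (forall x, 0 <= g x)%R ->
    \int[mu]_x (F x * (g x)%:E) <= K * 'N[mu]_q%:E[EFin \o g]) ->
  'N[mu]_p%:E[F] <= K.
Proof.
move=> /sigma_finiteP[E [ET ndE mE]] p1 pq mF F0 K0 hK.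
have p0 : (0 < p)%R by apply: lt_trans p1.
have q0 : (0 < q)%R.
  rewrite -invr_gt0 (_ : q^-1 = 1 - p^-1)%R; first by rewrite subr_gt0 invf_lt1.
  by rewrite -pq addrAC subrr add0r.
have [->|Ky] := eqVneq K +oo; first exact: leey.
pose G x := F x `^ p.
have G0 x : 0 <= G x by exact: poweR_ge0.
have mG : measurable_fun setT G.
  exact: (measurableT_comp (measurable_poweR p)).
have [h [ndh hG]] := approximation measurableT mG (fun x _ => G0 x).
pose e n x := (h n x * \1_(E n) x)%R.
have e0 n x : (0 <= e n x)%R by rewrite mulr_ge0.
have me n : measurable_fun setT (e n).
  by apply: measurable_funM => //; apply: measurable_indic; exact: (mE n).1.
have hle m n x : (m <= n)%N -> (h m x <= h n x)%R by move=> /ndh/lefP; exact.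
have eG n x : (e n x)%:E <= G x. 
  apply: (@le_trans _ _ (h n x)%:E).
    by rewrite lee_fin ler_piMr // indicE lern1 leq_b1.
  apply: cvge_to_ge (hG x Logic.I) _; near=> m; rewrite lee_fin.
  by apply: hle; near: m; exact: nbhs_infty_ge.
have cv : \int[mu]_x (e n x)%:E @[n --> \oo] --> \int[mu]_x G x.
  rewrite (_ : \int[mu]_x G x =
    \int[mu]_x limn (fun n => (e n x)%:E)); last first.
    apply: eq_integral => x _; apply/esym/cvg_lim => //.
    apply: cvg_trans (hG x Logic.I); apply: near_eq_cvg.
    have [N _ ENx] : (\bigcup_i E i) x by rewrite -ET.
    exists N => // n /= Nn; rewrite /e indicE mem_set ?mulr1 //.
    by have /subsetPset := ndE _ _ Nn; exact.
  apply: cvg_monotone_convergence => //.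
  - by move=> n; exact/measurable_EFinP.
  - by move=> n x _; rewrite lee_fin.
  - move=> x _ m n mn; rewrite lee_fin; apply: ler_pM => //.
      exact: hle.
    rewrite !indicE ler_nat; case: (boolP (x \in E m)) => // /set_mem Emx.
    by rewrite mem_set //; have /subsetPset := ndE _ _ mn; exact.
have eK n : \int[mu]_x (e n x)%:E <= K `^ p.
  set A := \int[mu]_x _.
  have A0 : 0 <= A by apply: integral_ge0 => x _; rewrite lee_fin.
  have Afin : A < +oo.
    have [M [Mr hM]] := simple_bounded (h n).
    have {}hM : forall x, (h n x <= `|M| + 1)%R.
      move=> x; apply: le_trans (ler_norm _) _; apply: (hM _ _ x) => //.
      by apply: le_lt_trans (ler_norm M) _; rewrite ltrDl.
    apply: (@le_lt_trans _ _ (\int[mu]_x ((`|M| + 1)%:E * (\1_(E n) x)%:E))).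
      apply: ge0_le_integral => //.
      + by move=> x _; rewrite lee_fin.
      + exact/measurable_EFinP.
      + apply: measurable_funeM; apply/measurable_EFinP.
        by apply: measurable_indic; exact: (mE n).1.
      + by move=> x _; rewrite -EFinM lee_fin ler_wpM2r.
    rewrite ge0_integralZl_EFin //; last first.
      by apply/measurable_EFinP; apply: measurable_indic; exact: (mE n).1.
    rewrite integral_indic //; last exact: (mE n).1.
    by rewrite setIT lte_mul_pinfty // ?lee_fin ?addr_ge0 // (mE n).2.
  pose g x := (e n x `^ q^-1)%R.
  have g0 x : (0 <= g x)%R by exact: powR_ge0.
  have mg : measurable_fun setT g.
    exact: (measurableT_comp (measurable_powR _)).
  have Ng : 'N[mu]_q%:E[EFin \o g] = A `^ q^-1.
    rewrite unlock; congr (_ `^ _); apply: eq_integral => x _ /=.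
    by rewrite ger0_norm // -powRrM mulVf ?gt_eqF // powRr1.
  have gL : g \in Lfun mu q%:E.
    rewrite inE; apply/andP; split; rewrite inE //= /finite_norm Ng.
    exact: poweR_lty.
  have AK : A <= K * A `^ q^-1.
    rewrite -Ng; apply: le_trans (hK g gL g0); apply: ge0_le_integral => //.
    + by move=> x _; rewrite lee_fin.
    + exact/measurable_EFinP.
    + by apply: emeasurable_funM => //; exact/measurable_EFinP.
    move=> x _; apply: (@le_trans _ _ ((e n x `^ p^-1)%:E * (g x)%:E)).
      by rewrite -EFinM lee_fin /g -powRD ?pq ?powRr1 // oner_eq0.
    apply: lee_wpmul2r; first by rewrite lee_fin.
    rewrite -poweR_EFin -[leRHS]poweRe1 //.
    (* F is written as (F^p)^(1/p), so that e n <= F^p can be used. *)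
    rewrite -[X in _ <= F x `^ X](@mulfV _ p) ?gt_eqF //.
    by rewrite poweRrM; apply: ge0_le_poweR; rewrite ?lee_fin ?invr_ge0 // ltW.
  have [->|A1] := eqVneq A 0; first exact: poweR_ge0.
  have Ap : 0 < A by rewrite lt0e A1.
  have Af : A \is a fin_num by rewrite ge0_fin_numE.
  have Aq0 : 0 < A `^ q^-1 by rewrite lt0e poweR_eq0 // negb_and A1 poweR_ge0.
  have : A `^ p^-1 <= K.
    rewrite -(@lee_pmul2r _ (A `^ q^-1)) //; last exact: fin_num_poweR.
    rewrite -poweRD; last by rewrite /poweRD_def pq oner_eq0.
    by rewrite pq poweRe1.
  move=> /(ge0_le_poweR (ltW p0) (poweR_ge0 _ _)).
  by rewrite -poweRrM mulVf ?gt_eqF // poweRe1.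
rewrite unlock.
under eq_integral do rewrite gee0_abs //.
have : \int[mu]_x G x <= K `^ p by apply: cvge_to_le cv _; exact: nearW.
have pV0 : (0 <= p^-1)%R by rewrite invr_ge0 ltW.
move=> /(ge0_le_poweR pV0 (integral_ge0 _ _)).
by rewrite -poweRrM mulfV ?gt_eqF // poweRe1 //; apply.
Unshelve. all: end_near. Qed.

End lnorm.

(** * Pairing the two weighted sums *)

Section metric_measure.
Context (d : measure_display) (R : realType) (X : borelMetricType d R).
Variable mu : {measure set X -> \bar R}.
Hypothesis hmu : metric_measure mu.

Lemma metric_measure_cball x r : mu (cball x r) < +oo.
Proof.
have [_ _ fin] := hmu.
by apply: fin; [exact: measurable_cball|exact: cball_bounded].
Qed.

Lemma metric_measure_Uball b x r : mu (Uball b x r) < +oo.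
Proof.
apply: le_lt_trans (metric_measure_cball x r).
apply: le_measure; rewrite ?inE.
- exact: measurable_Uball.
- exact: measurable_cball.
- exact: Uball_sub_cball.
Qed.

Lemma metric_measure_sigma_finite : sigma_finite setT mu.
Proof.
exists (fun n => cball (point : X) n%:R).
  apply/esym/seteqP; split=> // x _.
  exists (Num.Def.truncn (mdist (point : X) x)).+1 => //.
  rewrite /cball /=; apply: ltW.
  by rewrite truncnS_gt.
by move=> n; split; [exact: measurable_cball|exact: metric_measure_cball].
Qed.

Lemma uncentered_maximal_norm_ge0 q : 0 <= uncentered_maximal_norm mu q.
Proof. by apply: le_ereal_inf_tmp => c [c0 _]. Qed.

(** Dividing by the norm of [g], which is positive and finite, turns the bound by
each admissible constant into a bound by their infimum. *)
Lemma uncentered_maximal_norm_bound q g : g \in Lfun mu q%:E ->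
  'N[mu]_q%:E[EFin \o g] != 0 ->
  'N[mu]_q%:E[uncentered_maximal mu g] <=
    uncentered_maximal_norm mu q * 'N[mu]_q%:E[EFin \o g].
Proof.
move=> gL N0.
have : 'N[mu]_q%:E[EFin \o g] < +oo.
  by move: gL; rewrite inE => /andP[_]; rewrite inE.
have : 0 < 'N[mu]_q%:E[EFin \o g] by rewrite lt0e N0 Lnorm_ge0.
case e : 'N[mu]_q%:E[EFin \o g] => [r| |] //; rewrite lte_fin => r0 _.
rewrite -lee_pdivrMr //; apply: le_ereal_inf_tmp => c [c0 hc].
by rewrite lee_pdivrMr // -e; exact: hc.
Qed.

End metric_measure.

Section weighted_indicator.
Context (d : measure_display) (T : measurableType d) (R : realType).
Variable mu : {measure set T -> \bar R}.

Lemma weighted_indicator_ge0 (w : R) (A : set T) z : (0 <= w)%R ->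
  0 <= w%:E * (\1_A z)%:E / mu A.
Proof. by move=> w0; rewrite !mule_ge0 // inve_ge0. Qed.

Lemma measurable_weighted_indicator (w : R) (A : set T) : measurable A ->
  measurable_fun setT (fun z => w%:E * (\1_A z)%:E / mu A).
Proof.
move=> mA; apply: emeasurable_funM => //; apply: measurable_funeM.
by apply/measurable_EFinP; exact: measurable_indic.
Qed.

Lemma integral_weighted_indicator (w : R) (A : set T) (h : T -> \bar R) :
  (0 <= w)%R -> measurable A ->
  measurable_fun setT h -> (forall z, 0 <= h z) ->
  \int[mu]_z (w%:E * (\1_A z)%:E / mu A * h z) =
    w%:E * ((mu A)^-1 * \int[mu]_(z in A) h z).
Proof.
move=> w0 mA mh h0.
rewrite (integral_mkcond A) -ge0_integralZl //; last 3 first.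
- by apply/(measurable_restrictT _ _).1 => //; exact: measurable_funTS.
- by move=> x _; exact: erestrict_ge0.
- by rewrite inve_ge0.
rewrite -ge0_integralZl_EFin //; last 2 first.
- by move=> x _; rewrite mule_ge0 ?inve_ge0 //; exact: erestrict_ge0.
- apply: measurable_funeM; apply/(measurable_restrictT _ _).1 => //.
  exact: measurable_funTS.
apply: eq_integral => z _; rewrite /patch indicE.
by case: ifPn => zA; rewrite ?mule1 ?mule0 ?mul0e ?muleA.
Qed.

End weighted_indicator.

Section pairing.
Context (d : measure_display) (R : realType) (X : borelMetricType d R).
Variable mu : {measure set X -> \bar R}.
Hypothesis hmu : metric_measure mu.

(** The left-hand average is a constant that bounds M g from below at each point
of the large ball, in particular on the small one; the right-hand side averages
M g over the small ball. *)
Lemma average_dilation_le b x r s (g : X -> R) : measurable_fun setT g ->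
  (r <= s)%R -> 0 < mu (Uball b x r) ->
  (mu (Uball b x s))^-1 * \int[mu]_(z in Uball b x s) `|(g z)%:E| <=
  (mu (Uball b x r))^-1 *
    \int[mu]_(z in Uball b x r) `|uncentered_maximal mu g z|.
Proof.
move=> mg rs mur; set A := Uball b x s; set B := Uball b x r.
have mA : measurable A := measurable_Uball b x s.
have mB : measurable B := measurable_Uball b x r.
have BA : B `<=` A := le_Uball rs.
have muA : 0 < mu A.
  by apply: (lt_le_trans mur); apply: le_measure; rewrite ?inE.
have Af : mu A \is a fin_num.
  by rewrite ge0_fin_numE //; exact: metric_measure_Uball.
have Bf : mu B \is a fin_num.
  by rewrite ge0_fin_numE //; exact: metric_measure_Uball.
set a := (mu A)^-1 * _.
rewrite -(@lee_pmul2l _ (mu B)) // [leRHS]muleA divee ?gt_eqF // mul1e.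
rewrite [leLHS]muleC -integral_cst //; apply: ge0_le_integral => //.
- by move=> z _; rewrite mule_ge0 ?inve_ge0 // integral_ge0.
- apply: measurable_funTS; apply: measurableT_comp => //.
  exact: measurable_uncentered_maximal.
move=> z Bz; rewrite /= /a -(@lee_pmul2l _ (mu A)) //.
rewrite [leLHS]muleA divee ?gt_eqF // mul1e [leRHS]muleC.
apply: integral_Uball_le_maximal => //.
  exact: metric_measure_cball.
exact: BA.
Qed.

Context (I : countType) (w t r : I -> R) (x : I -> X) (c : I -> bool).
Hypotheses (hw : forall n, (0 <= w n)%R) (ht : forall n, (1 <= t n)%R)
  (hr : forall n, (0 <= r n)%R)
  (hU : forall n, 0 < mu (Uball (c n) (x n) (r n))).

Lemma integral_dilated_sum_le (g : X -> R) : measurable_fun setT g ->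
  (forall z, 0 <= g z)%R ->
  \int[mu]_z ((\esum_(n in [set: I])
      ((w n)%:E * (\1_(Uball (c n) (x n) (t n * r n)) z)%:E
         / mu (Uball (c n) (x n) (t n * r n)))) * (g z)%:E) <=
  \int[mu]_z ((\esum_(n in [set: I])
      ((w n)%:E * (\1_(Uball (c n) (x n) (r n)) z)%:E
         / mu (Uball (c n) (x n) (r n)))) * `|uncentered_maximal mu g z|).
Proof.
move=> mg g0.
have mM : measurable_fun setT (fun z => `|uncentered_maximal mu g z|).
  by apply: measurableT_comp => //; exact: measurable_uncentered_maximal.
have meg : measurable_fun setT (EFin \o g) by exact/measurable_EFinP.
have mU b y s := measurable_Uball (X := X) b y s.
under eq_integral => z _ do rewrite (esum_mulr (g0 z)
  (fun i => weighted_indicator_ge0 mu (Uball (c i) (x i) (t i * r i)) z (hw i))).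
rewrite integral_esum; last 2 first.
- by move=> i z; rewrite mule_ge0 ?lee_fin //; exact: weighted_indicator_ge0.
- move=> i; apply: emeasurable_funM => //.
  exact: measurable_weighted_indicator.
apply: (@le_trans _ _ (\int[mu]_z \esum_(n in [set: I])
   ((w n)%:E * (\1_(Uball (c n) (x n) (r n)) z)%:E
         / mu (Uball (c n) (x n) (r n)) * `|uncentered_maximal mu g z|))).
  rewrite integral_esum; last 2 first.
  - by move=> i z; rewrite mule_ge0 //; exact: weighted_indicator_ge0.
  - move=> i; apply: emeasurable_funM => //.
    exact: measurable_weighted_indicator.
  apply: le_esum => i _.
  rewrite !integral_weighted_indicator //.
  apply: lee_wpmul2l; first by rewrite lee_fin.
  rewrite (eq_integral (fun z => `|(g z)%:E|)) => [|z _]; last first.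
    by rewrite gee0_abs ?lee_fin.
  by apply: average_dilation_le => //; rewrite ler_peMl.
apply: ge0_le_integral => //.
- move=> z _; apply: esum_ge0 => i _; rewrite mule_ge0 //.
  exact: weighted_indicator_ge0.
- apply: measurable_fun_esum => [i z|i].
    by rewrite mule_ge0 //; exact: weighted_indicator_ge0.
  by apply: emeasurable_funM => //; exact: measurable_weighted_indicator.
- apply: emeasurable_funM => //; apply: measurable_fun_esum => [i z|i].
    exact: weighted_indicator_ge0.
  exact: measurable_weighted_indicator.
by move=> z _; apply: esum_mulr_le => // i; exact: weighted_indicator_ge0.
Qed.

End pairing.

Theorem theorem3p2 (d : measure_display) (R : realType)
  (X : borelMetricType d R) (mu : {measure set X -> \bar R})
  (hmu : metric_measure mu)
  (p q : R) (hp : (1 < p)%R) (hq : q = (p / (p - 1))%R)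
  (I : countType) (w t r : I -> R) (x : I -> X) (c : I -> bool)
  (hw : forall n, (0 < w n)%R) (ht : forall n, (1 <= t n)%R)
  (hr : forall n, (0 < r n)%R)
  (hU : forall n, 0 < mu (Uball (c n) (x n) (r n))) :
  'N[mu]_(p%:E)[(fun z => \esum_(n in [set: I])
      ((w n)%:E * (\1_(Uball (c n) (x n) (t n * r n)) z)%:E
         / mu (Uball (c n) (x n) (t n * r n))))]
  <= uncentered_maximal_norm mu q *
     'N[mu]_(p%:E)[(fun z => \esum_(n in [set: I])
        ((w n)%:E * (\1_(Uball (c n) (x n) (r n)) z)%:E
           / mu (Uball (c n) (x n) (r n))))].
Proof.
have w0 n : (0 <= w n)%R := ltW (hw n).
have r0 n : (0 <= r n)%R := ltW (hr n).
have p0 : (0 < p)%R by apply: lt_trans hp.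
have p10 : (0 < p - 1)%R by rewrite subr_gt0.
have q0 : (0 < q)%R by rewrite hq divr_gt0.
have pq : (p^-1 + q^-1 = 1)%R by rewrite hq; field; lra.
set Ft := (X in 'N[mu]_p%:E[X] <= _).
set F := (X in _ <= _ * 'N[mu]_p%:E[X]).
have Ft0 z : 0 <= Ft z by apply: esum_ge0 => n _; exact: weighted_indicator_ge0.
have mFt : measurable_fun setT Ft.
  apply: measurable_fun_esum => [n z|n]; first exact: weighted_indicator_ge0.
  by apply: measurable_weighted_indicator; exact: measurable_Uball.
have F0 z : 0 <= F z by apply: esum_ge0 => n _; exact: weighted_indicator_ge0.
have mF : measurable_fun setT F.
  apply: measurable_fun_esum => [n z|n]; first exact: weighted_indicator_ge0.
  by apply: measurable_weighted_indicator; exact: measurable_Uball.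
apply: (Lnorm_le_dual (metric_measure_sigma_finite hmu) hp pq mFt Ft0).
  by apply: mule_ge0; [exact: uncentered_maximal_norm_ge0|exact: Lnorm_ge0].
move=> g gL g0.
have mg : measurable_fun setT g by move: gL; rewrite inE => /andP[/[!inE]].
(* For [g] of norm zero, Hoelder's inequality on the left-hand side gives 0. *)
have [Ng0|Ng0] := eqVneq 'N[mu]_q%:E[EFin \o g] 0.
  rewrite Ng0 mule0 -(mule0 'N[mu]_p%:E[Ft]) -Ng0.
  apply: le_trans (hoelder_ereal _ mFt _ p0 q0 pq); last exact/measurable_EFinP.
  rewrite le_eqVlt; apply/orP; left; apply/eqP; apply: eq_integral => z _.
  by rewrite gee0_abs // mule_ge0 ?lee_fin.
have dil := integral_dilated_sum_le hmu w0 ht r0 hU mg g0.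
apply: (le_trans dil) => {dil}.
apply: (@le_trans _ _ ('N[mu]_p%:E[F] * 'N[mu]_q%:E[uncentered_maximal mu g])).
  have mM := measurable_uncentered_maximal mu g.
  apply: le_trans (hoelder_ereal _ mF mM p0 q0 pq).
  rewrite le_eqVlt; apply/orP; left; apply/eqP; apply: eq_integral => z _.
  by rewrite abseM (gee0_abs (F0 z)).
rewrite [X in _ <= X * _]muleC -muleA.
apply: lee_wpmul2l; first exact: Lnorm_ge0.
exact: uncentered_maximal_norm_bound.
Qed.
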